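(* Let $J\subseteq\mathbb{Z}[x_0,\dots,x_n]$ be a strongly stable $m$-truncation ideal and $\sigma$ be a term ordering. Then the Gröbner functor $\underline{\mathbf{St}}_J^\sigma$ is a closed subfunctor of $\underline{\mathbf{Mf}}_J$. Moreover $\underline{\mathbf{St}}_J^\sigma$ is represented by the affine scheme $\mathbf{St}_J^\sigma:=\operatorname{Spec}\mathbb{Z}[\mathbf{C}]/\mathfrak{I}_J^\sigma$, where $\mathfrak{I}_J^\sigma$ is the sum of the ideal $\mathfrak{I}_J$ and the ideal $\mathfrak{G}_J^\sigma:=(C_{\alpha\beta}\mid x^\beta>_\sigma x^\alpha)$.
   Context: All rings are commutative, noetherian, with unit. $A[\mathbf{x}]=A[x_0,\dots,x_n]$ with variables ordered $x_0<\dots<x_n$. ${}_A\langle H\rangle$ is the $A$-module generated by $H$; $D_s$ is the degree-$s$ part of $D$. A monomial ideal $J$ is strongly stable if for every monomial $x^\alpha\in J$, every $x_j\mid x^\alpha$ and every $x_i>x_j$, one has $\frac{x_i}{x_j}x^\alpha\in J$. $J$ is an $m$-truncation if $J=J'_{\ge m}$ (the part of degree $\ge m$) for a saturated strongly stable ideal $J'$. $\mathcal{B}_J$ is the minimal monomial generating set of $J$ and $\mathcal{N}(J)$ the set of monomials not in $J$; the same letter $J$ denotes the monomial ideal with the same monomials in any $A[\mathbf{x}]$. The marked functor $\underline{\mathbf{Mf}}_J$ (noetherian rings to sets) sends $A$ to $\{\text{homogeneous ideals } I\subseteq A[\mathbf{x}]\mid A[\mathbf{x}]=I\oplus{}_A\langle\mathcal{N}(J)\rangle\}$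 and $A\to B$ to $I\mapsto I\otimes_A B\subseteq B[\mathbf{x}]$. $\sigma$ is a term ordering on the monomials in $\mathbf{x}$. An ideal $I\subseteq A[\mathbf{x}]$ is monic (with respect to $\sigma$) if for every monomial $x^\alpha$ the set $\mathrm{LC}(I,x^\alpha)=\{a\in A\mid ax^\alpha\text{ is the leading term of some } g\in I\}\cup\{0\}$ is either $\{0\}$ or $A$. For a monic ideal $I$, $\mathrm{in}_\sigma(I)$ is the monomial ideal generated by the leading monomials of elements of $I$. The Gröbner functor $\underline{\mathbf{St}}_J^\sigma$ sends $A$ to $\{\text{monic homogeneous ideals } I\subseteq A[\mathbf{x}]\mid\mathrm{in}_\sigma(I)=J\}$ (equivalently, ideals $I$ generated by a reduced Gröbner basis $\{x^\alpha-\sum b_{\alpha\beta}x^\beta\mid x^\alpha\in\mathcal{B}_J\}$, sums over $x^\beta\in\mathcal{N}(J)_{|\alpha|}$ with $x^\beta<_\sigma x^\alpha$, and $\mathrm{in}_\sigma(I)=J$) and $A\to B$ to $I\mapsto I\otimes_A B$. One has $\underline{\mathbf{St}}_J^\sigma(A)\subseteq\underline{\mathbf{Mf}}_J(A)$ for every $A$. $\mathbf{C}$ is the set of variables $C_{\alpha\beta}$, with $x^\alpha\in\mathcal{B}_J$, $x^\beta\in\mathcal{N}(J)_{|\alpha|}$. $\mathcal{I}$ is the ideal of $\mathbb{Z}[\mathbf{C}][\mathbf{x}]$ generated by $\{x^\alpha-\sum_{x^\beta\in\mathcal{N}(J)_{|\alpha|}}C_{\alpha\beta}x^\beta\mid x^\alpha\in\mathcal{B}_J\}$.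 $\mathfrak{I}_J$ is the ideal of $\mathbb{Z}[\mathbf{C}]$ generated by the coefficients (in $\mathbb{Z}[\mathbf{C}]$, of the monomials in $\mathbf{x}$) of all polynomials in $\mathcal{I}\cap{}_{\mathbb{Z}[\mathbf{C}]}\langle\mathcal{N}(J)\rangle$. *)

(* Defs.v *)
From HB Require Import structures.
From mathcomp Require Import all_boot all_order all_algebra.
From mathcomp Require Import generic_quotient.
From mathcomp Require Import boolp classical_sets functions.
(* The notations and names of monalg clash with those of mpoly; it only serves
   to form Z[C], whose variables are indexed by a choice type. *)
From mathcomp Require Import -(notations) monalg.
From mathcomp Require Import mpoly.

Set Implicit Arguments.
Unset Strict Implicit.
Unset Printing Implicit Defensive.

Import GRing.Theory.

Local Open Scope classical_set_scope.
Local Open Scope ring_scope.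

Section Ideals.
Variable R : comPzRingType.

(* Ideals may be improper. *)
Definition is_ideal (I : set R) : Prop :=
  [/\ I 0, forall u v, I u -> I v -> I (u + v) & forall a u, I u -> I (a * u)].

Definition ideal_gen (S : set R) : set R := smallest is_ideal S.

Definition noetherian : Prop :=
  forall I : set R, is_ideal I -> exists s : seq R, I = ideal_gen [set` s].

Record ideal := Ideal { ideal_set :> set R; ideal_setP : is_ideal ideal_set }.

Lemma ideal_gen_is_ideal (S : set R) : is_ideal (ideal_gen S).
Proof.
split=> [K [[]]|u v hu hv K hK|a u hu K hK] //.
- by have [[_ hD _] _] := hK; apply: hD; [apply: hu | apply: hv].
- by have [[_ _ hM] _] := hK; apply: hM; apply: hu.
Qed.

Definition ideal_span (S : set R) : ideal := Ideal (ideal_gen_is_ideal S).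

Lemma ideal_add_is_ideal (I K : ideal) :
  is_ideal [set x | exists u v, [/\ ideal_set I u, ideal_set K v & x = u + v]].
Proof.
have [I0 ID IM] := ideal_setP I; have [K0 KD KM] := ideal_setP K.
split=> [|_ _ [u1 [v1 [hu1 hv1 ->]]] [u2 [v2 [hu2 hv2 ->]]]
         |a _ [u [v [hu hv ->]]]].
- by exists 0, 0; rewrite addr0.
- exists (u1 + u2), (v1 + v2); rewrite addrACA.
  by split; [apply: ID | apply: KD |].
- exists (a * u), (a * v); rewrite mulrDr.
  by split; [apply: IM | apply: KM |].
Qed.

Definition ideal_add (I K : ideal) : ideal := Ideal (ideal_add_is_ideal I K).

End Ideals.

(* The quotient ring R / I, along the lines of ring_quotient.v, which only
   treats proper ideals given by boolean predicates. *)
Section QuotientRing.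
Variables (R : comPzRingType) (I : ideal R).
Local Open Scope quotient_scope.

Definition ideal_equiv (x y : R) : bool := `[< ideal_set I (x - y) >].

Lemma ideal_equiv_class : equiv_class_of ideal_equiv.
Proof.
have [I0 ID IM] := ideal_setP I.
have IN x : ideal_set I x -> ideal_set I (- x).
  by move=> /(IM (-1)); rewrite mulN1r.
split=> [x|x y|y x z].
- by apply/asboolP; rewrite subrr.
- by apply/asboolP/asboolP => /IN; rewrite opprB.
- move=> /asboolP hxy /asboolP hyz; apply/asboolP.
  by have := ID _ _ hxy hyz; rewrite addrA subrK.
Qed.

Canonical ideal_equiv_equiv := EquivRelPack ideal_equiv_class.
Canonical ideal_equiv_encModRel := defaultEncModRel ideal_equiv.

Definition ring_quot := {eq_quot ideal_equiv}.
HB.instance Definition _ : EqQuotient R ideal_equiv ring_quot :=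
  EqQuotient.on ring_quot.
HB.instance Definition _ := Choice.on ring_quot.

Lemma ring_quotP (x y : R) :
  ideal_set I (x - y) <-> \pi_ring_quot x = \pi_ring_quot y.
Proof.
split=> [h|/eqP]; first by apply/eqP; rewrite piE; apply/asboolP.
by rewrite piE => /asboolP.
Qed.

Definition rq_zero : ring_quot := lift_cst ring_quot 0.
Definition rq_add := lift_op2 ring_quot +%R.
Definition rq_opp := lift_op1 ring_quot -%R.
Definition rq_one : ring_quot := lift_cst ring_quot 1.
Definition rq_mul := lift_op2 ring_quot *%R.

Canonical rq_pi_zero := PiConst rq_zero.
Canonical rq_pi_one := PiConst rq_one.

Lemma rq_repr x : ideal_set I (repr (\pi_ring_quot x) - x).
Proof. by apply/ring_quotP; rewrite reprK. Qed.

Lemma rq_oppE : {morph \pi_ring_quot : x / - x >-> rq_opp x}.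
Proof.
have [I0 ID IM] := ideal_setP I.
move=> x; unlock rq_opp; apply/ring_quotP; rewrite opprK addrC.
exact: rq_repr.
Qed.
Canonical rq_pi_opp := PiMorph1 rq_oppE.

Lemma rq_addE : {morph \pi_ring_quot : x y / x + y >-> rq_add x y}.
Proof.
have [I0 ID IM] := ideal_setP I.
move=> x y; unlock rq_add; apply/esym/ring_quotP; rewrite opprD addrACA.
by apply: ID; apply: rq_repr.
Qed.
Canonical rq_pi_add := PiMorph2 rq_addE.

Lemma rq_mulE : {morph \pi_ring_quot : x y / x * y >-> rq_mul x y}.
Proof.
have [I0 ID IM] := ideal_setP I.
move=> x y; unlock rq_mul; apply/esym/ring_quotP.
set x' := repr _; set y' := repr _.
have -> : x' * y' - x * y = y' * (x' - x) + x * (y' - y).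
  by rewrite !mulrBr addrA [y' * x]mulrC subrK [y' * x']mulrC.
by apply: ID; apply: IM; apply: rq_repr.
Qed.
Canonical rq_pi_mul := PiMorph2 rq_mulE.

Lemma rq_addA : associative rq_add.
Proof. by move=> x y z; rewrite -[x]reprK -[y]reprK -[z]reprK !piE addrA. Qed.
Lemma rq_addC : commutative rq_add.
Proof. by move=> x y; rewrite -[x]reprK -[y]reprK !piE addrC. Qed.
Lemma rq_add0 : left_id rq_zero rq_add.
Proof. by move=> x; rewrite -[x]reprK !piE add0r. Qed.
Lemma rq_addN : left_inverse rq_zero rq_opp rq_add.
Proof. by move=> x; rewrite -[x]reprK !piE addNr. Qed.
HB.instance Definition _ :=
  GRing.isZmodule.Build ring_quot rq_addA rq_addC rq_add0 rq_addN.

Lemma rq_mulA : associative rq_mul.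
Proof. by move=> x y z; rewrite -[x]reprK -[y]reprK -[z]reprK !piE mulrA. Qed.
Lemma rq_mulC : commutative rq_mul.
Proof. by move=> x y; rewrite -[x]reprK -[y]reprK !piE mulrC. Qed.
Lemma rq_mul1 : left_id rq_one rq_mul.
Proof. by move=> x; rewrite -[x]reprK !piE mul1r. Qed.
Lemma rq_mulDl : left_distributive rq_mul rq_add.
Proof.
by move=> x y z; rewrite -[x]reprK -[y]reprK -[z]reprK !piE mulrDl.
Qed.
HB.instance Definition _ :=
  GRing.Zmodule_isComPzRing.Build ring_quot rq_mulA rq_mulC rq_mul1 rq_mulDl.

End QuotientRing.

Section MonomialIdeals.
Variable n : nat.
Local Notation mon := 'X_{1..n.+1}.

Section Coefficients.
Variable A : comNzRingType.
Local Notation Ax := {mpoly A[n.+1]}.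
Implicit Types (I H : set Ax) (M : set mon).

Definition is_submodule H : Prop :=
  [/\ H 0, forall p q, H p -> H q -> H (p + q)
    & forall (a : A) p, H p -> H (a *: p)].

Definition module_gen H : set Ax := smallest is_submodule H.

Definition monomials M : set Ax := [set 'X_[a] | a in M].

Definition homogeneous I : Prop :=
  forall p, I p -> forall d, I (pihomog mdeg d p).

Definition direct_sum_decomposition I H : Prop :=
  I `&` H = [set 0] /\ forall p, exists f h, [/\ I f, H h & p = f + h].

(* [I : (x_0, ..., x_n)^oo = I]; the monomials of degree k generate the k-th
   power of the irrelevant ideal. *)
Definition saturated I : Prop :=
  forall p k, (forall b : mon, mdeg b = k -> I ('X_[b] * p)) -> I p.

Definition truncation I (m : nat) : set Ax :=
  [set p | I p /\ forall a, a \in msupp p -> (m <= mdeg a)%N].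

End Coefficients.
Arguments monomials : clear implicits.

Definition mons (J : set {mpoly int[n.+1]}) : set mon := [set a | J 'X_[a]].

(* The variables are ordered x_0 < ... < x_n. *)
Definition strongly_stable (J : set {mpoly int[n.+1]}) : Prop :=
  J = ideal_gen (monomials int (mons J)) /\
  forall (a : mon) (i j : 'I_n.+1), mons J a -> (0 < a j)%N -> (j < i)%N ->
    mons J (a - U_(j) + U_(i))%MM.

Definition is_truncation (m : nat) (J : set {mpoly int[n.+1]}) : Prop :=
  exists J', [/\ strongly_stable J', saturated J' & J = truncation J' m].

Variable J : set {mpoly int[n.+1]}.

(* The ideal of A[x] with the same monomials as J. *)
Definition ideal_over (A : comNzRingType) : set {mpoly A[n.+1]} :=
  ideal_gen (monomials A (mons J)).
Arguments ideal_over : clear implicits.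

Definition min_gens : set mon :=
  [set a | mons J a /\ forall b, mons J b -> (b <= a)%MM -> b = a].

Definition sous_escalier : set mon := [set a | ~ mons J a].

Definition marked_functor (A : comNzRingType) : set (set {mpoly A[n.+1]}) :=
  [set I | [/\ is_ideal I, homogeneous I &
     direct_sum_decomposition I (module_gen (monomials A sous_escalier))]].

Variable sigma : rel mon.

(* [sigma a b] reads x^a <=_sigma x^b. *)
Definition term_ordering : Prop :=
  [/\ antisymmetric sigma, transitive sigma, total sigma,
      forall a, sigma 0%MM a &
      forall a b c, sigma a b -> sigma (a + c)%MM (b + c)%MM].

Definition is_lead (A : comNzRingType) (p : {mpoly A[n.+1]}) (a : mon) : Prop :=
  a \in msupp p /\ forall b, b \in msupp p -> sigma b a.

Definition LC (A : comNzRingType) (I : set {mpoly A[n.+1]}) (a : mon) : set A :=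
  [set c | exists p, [/\ I p, is_lead p a & p@_a = c]] `|` [set 0].

Definition monic (A : comNzRingType) (I : set {mpoly A[n.+1]}) : Prop :=
  forall a, LC I a = [set 0] \/ LC I a = setT.

Definition initial_ideal (A : comNzRingType) (I : set {mpoly A[n.+1]}) :
    set {mpoly A[n.+1]} :=
  ideal_gen (monomials A [set a | exists2 p, I p & is_lead p a]).

Definition groebner_functor (A : comNzRingType) : set (set {mpoly A[n.+1]}) :=
  [set I | [/\ is_ideal I, homogeneous I, monic I &
               initial_ideal I = ideal_over A]].

(* The pairs (a, b) indexing the variables C_ab. *)
Definition Cindex : choiceType :=
  {ab : mon * mon | `[< [/\ min_gens ab.1, sous_escalier ab.2
                          & mdeg ab.2 = mdeg ab.1] >]}.

Definition ZC : comNzRingType := malg (cmonom Cindex) int.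

Definition Cvar (i : Cindex) : ZC := mkmalgU (ucm i) 1.

(* C_ab, and 0 when (a, b) is not an index. *)
Definition Ccoef (a b : mon) : ZC := oapp Cvar 0 (insub (a, b)).

(* The sum has finitely many terms: 'X_{1..n.+1 < d.+1} is the finite type of
   monomials of degree at most d; [Ccoef] selects the degree d and b \notin J. *)
Definition marked_poly (a : mon) : {mpoly ZC[n.+1]} :=
  'X_[a] - \sum_(b : 'X_{1..n.+1 < (mdeg a).+1}) Ccoef a b *: 'X_[b].

Definition universal_ideal : set {mpoly ZC[n.+1]} :=
  ideal_gen [set marked_poly a | a in min_gens].

Definition frakI : ideal ZC :=
  ideal_span [set c | exists p m,
    [/\ universal_ideal p, module_gen (monomials ZC sous_escalier) p
      & c = p@_m]].

Definition frakG : ideal ZC :=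
  ideal_span [set Cvar i | i in [set i : Cindex |
    sigma (val i).1 (val i).2 /\ (val i).1 <> (val i).2]].

Definition frakI_sigma : ideal ZC := ideal_add frakI frakG.

End MonomialIdeals.

Arguments monomials {n} A M _.
Arguments ideal_over {n} J A _.
Arguments marked_functor {n} J A _.
Arguments groebner_functor {n} J sigma A _.

(* Functors from noetherian rings to sets whose value at A is a set of ideals
   of A[x_0, ..., x_n] and which act on morphisms by I |-> I (x)_A B, viewed
   in B[x_0, ..., x_n]. *)
Section Functors.
Variable n : nat.

Definition base_change (A B : comNzRingType) (f : A -> B)
    (I : set {mpoly A[n.+1]}) : set {mpoly B[n.+1]} :=
  ideal_gen (map_mpoly f @` I).

Definition ideal_family :=
  forall A : comNzRingType, set (set {mpoly A[n.+1]}).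

Definition is_functor (F : ideal_family) : Prop :=
  [/\ forall (A B : comNzRingType) (f : {rmorphism A -> B}),
        noetherian A -> noetherian B ->
        forall I, F A I -> F B (base_change f I),
      forall A : comNzRingType, noetherian A ->
        forall I, F A I -> base_change (@idfun A) I = I
    & forall (A B D : comNzRingType) (f : {rmorphism A -> B})
             (g : {rmorphism B -> D}),
        noetherian A -> noetherian B -> noetherian D ->
        forall I, F A I ->
          base_change (g \o f) I = base_change g (base_change f I)].

Definition is_subfunctor (F G : ideal_family) : Prop :=
  [/\ is_functor F, is_functor G
    & forall A : comNzRingType, noetherian A -> F A `<=` G A].

(* F is a closed subfunctor of G: by Yoneda, a morphism h_A -> G is an element
   I of G(A); the fibre product of F and h_A over G has to be the functor of
   points of a closed subscheme Spec A/a of Spec A, i.e. to consist of the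
   A -> B that vanish on a. *)
Definition closed_subfunctor (F G : ideal_family) : Prop :=
  is_subfunctor F G /\
  forall A : comNzRingType, noetherian A -> forall I, G A I ->
    exists a : ideal A,
      forall (B : comNzRingType) (f : {rmorphism A -> B}), noetherian B ->
        F B (base_change f I) <-> (forall x, ideal_set a x -> f x = 0).

(* F is isomorphic to the functor of points of Spec R on affine schemes:
   Hom(Spec A, Spec R) is the set of ring morphisms from R to A. *)
Definition represented_by_Spec (F : ideal_family) (R : comPzRingType) : Prop :=
  exists eta : forall A : comNzRingType,
      {rmorphism R -> A} -> set {mpoly A[n.+1]},
    (forall A : comNzRingType, noetherian A ->
       set_bij [set: {rmorphism R -> A}] (F A) (eta A)) /\
    (forall (A B : comNzRingType) (f : {rmorphism A -> B}),
       noetherian A -> noetherian B -> forall phi : {rmorphism R -> A},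
       eta B (GRing.RMorphism.clone R B (f \o phi) _)
       = base_change f (eta A phi)).

End Functors.

(* Main.v *)
(* For strongly stable J every monomial reduces modulo the universal ideal to
   a combination of monomials outside J: write it as x^c x^a with x^a a minimal
   generator and the variables of x^c at most those of x^a, and replace x^a by
   its tail; each new monomial in J has a lexicographically smaller cofactor
   x^c. An ideal with such normal forms is, as a module, the kernel of the
   normal form map exactly when that map vanishes on it, and this vanishing is
   what Z[C] -> A killing frakI expresses; it also passes to base changes.
   On the other hand, the Groebner functor consists of the marked ideals
   whose normal forms of the monomials x^d in J only involve monomials smaller
   than x^d. This is the vanishing of some coefficients, hence a closed
   condition; for the universal ideal it suffices to ask it of the minimal
   generators, which gives frakG. *)
Require Import Defs.
From HB Require Import structures.
From mathcomp Require Import all_boot all_order all_algebra.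
From mathcomp Require Import generic_quotient finmap.
From mathcomp Require Import boolp classical_sets.
From mathcomp Require Import -(notations) monalg.
From mathcomp Require Import ssrcomplements mpoly.

Set Implicit Arguments.
Unset Strict Implicit.
Unset Printing Implicit Defensive.

Import GRing.Theory.

Local Open Scope classical_set_scope.
Local Open Scope ring_scope.

(** * Closure properties of ideals, preimages and kernels *)

Section Ideals.
Variables (R : comPzRingType) (I : set R).
Hypothesis idI : is_ideal I.

Lemma ideal0 : I 0. Proof. by have [] := idI. Qed.

Lemma idealD u v : I u -> I v -> I (u + v).
Proof. by have [_ + _] := idI; exact. Qed.

Lemma idealMl a u : I u -> I (a * u).
Proof. by have [_ _] := idI; exact. Qed.

Lemma idealN u : I u -> I (- u).
Proof. by rewrite -mulN1r; exact: idealMl. Qed.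

Lemma idealB u v : I u -> I v -> I (u - v).
Proof. by move=> Iu /idealN; exact: idealD. Qed.

End Ideals.

Lemma preimage_is_ideal (R S : comPzRingType) (f : {rmorphism R -> S}) I :
  is_ideal I -> is_ideal [set x | I (f x)].
Proof.
move=> idI; split=> [|u v fu fv|a u fu] /=.
- by rewrite rmorph0; exact: (ideal0 idI).
- by rewrite rmorphD; exact: (idealD idI).
- by rewrite rmorphM; exact: (idealMl idI).
Qed.

Lemma kernel_is_ideal (R S : comPzRingType) (f : {rmorphism R -> S}) :
  is_ideal [set x | f x = 0].
Proof.
apply: (preimage_is_ideal f (I := [set 0])).
by split=> [|_ _ -> ->|a _ ->] //=; rewrite ?addr0 ?mulr0.
Qed.

(** * Induction along a strict order on monomials of bounded degree *)

Section FiniteInduction.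
Variables (n : nat) (r : 'X_{1..n} -> 'X_{1..n} -> Prop).
Hypotheses (r_irr : forall a, ~ r a a)
           (r_trans : forall b a c, r a b -> r b c -> r a c).

(** Only finitely many monomials have degree at most [s], and the number of those below [a] drops
    along [r]. This serves both for term orderings and for the lexicographic order on cofactors. *)
Lemma bounded_mon_ind s (P : 'X_{1..n} -> Prop) :
  (forall a, (mdeg a <= s)%N ->
     (forall b, (mdeg b <= s)%N -> r b a -> P b) -> P a) ->
  forall a, (mdeg a <= s)%N -> P a.
Proof.
move=> IH a; pose below a := [pred b : 'X_{1..n < s.+1} | `[< r b a >]].
have [k] := ubnP #|below a|; elim: k a => // k IHk a lt_k le_s.
apply: IH => // b le_b rba; apply: (IHk b) => //.
apply: leq_trans (proper_card _) lt_k.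
have lt_b : (mdeg b < s.+1)%N by [].
apply/properP; split.
  apply/fintype.subsetP => c /asboolP rcb.
  by apply/asboolP; exact: r_trans rcb rba.
by exists (BMultinom lt_b); apply/asboolP => // /r_irr.
Qed.

End FiniteInduction.

(** * Coefficients, homogeneous parts and linear maps of polynomials *)

Section MPoly.
Variables (n : nat) (A : comNzRingType).
Local Notation mon := 'X_{1..n}.
Local Notation Ax := {mpoly A[n]}.
Implicit Types (p q : Ax) (m a b : mon) (h : mon -> Ax).

Lemma mpoly_supp_ind (P : Ax -> Prop) p :
  P 0 -> (forall q r, P q -> P r -> P (q + r)) ->
  (forall c q, P q -> P (c *: q)) ->
  (forall m, m \in msupp p -> P 'X_[m]) -> P p.
Proof.
move=> P0 PD PZ PX; rewrite [p]mpolyE big_seq.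
by apply: big_ind => // m /PX; exact: PZ.
Qed.

Lemma mpoly_is_ideal (K : set Ax) :
  K 0 -> (forall p q, K p -> K q -> K (p + q)) ->
  (forall c p, K p -> K (c *: p)) -> (forall m p, K p -> K ('X_[m] * p)) ->
  is_ideal K.
Proof.
move=> K0 KD KZ KX; split=> // a u Ku.
apply: (@mpoly_supp_ind (fun a : Ax => K (a * u)) a) => [|q r|c q|m _].
- by rewrite mul0r.
- by rewrite mulrDl; exact: KD.
- by rewrite -scalerAl; exact: KZ.
- exact: KX.
Qed.

Lemma idealZ (I : set Ax) : is_ideal I -> forall c p, I p -> I (c *: p).
Proof. by move=> idI c p; rewrite -mul_mpolyC; exact: idealMl. Qed.

Lemma mcoeffXM m p a :
  ('X_[m] * p)@_a = if (m <= a)%MM then p@_(a - m) else 0.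
Proof.
rewrite mulrC; case: ifPn => [le_ma|nle].
  by rewrite -{1}(submK le_ma) addmC mcoeffMX.
apply: memN_msupp_eq0; rewrite (perm_mem (msuppMX _ _)).
by apply/mapP => -[b _ e]; rewrite e lem_addr in nle.
Qed.

Lemma mcoeff_pihomog d p a :
  (pihomog mdeg d p)@_a = if mdeg a == d then p@_a else 0.
Proof.
apply: (mpoly_supp_ind (P := fun p =>
  (pihomog mdeg d p)@_a = if mdeg a == d then p@_a else 0)) => [|q r|c q|m _].
- by rewrite pihomog0 mcoeff0 if_same.
- by rewrite pihomogD !mcoeffD => -> ->; case: ifP; rewrite ?addr0.
- by rewrite linearZ !mcoeffZ => ->; case: ifP; rewrite ?mulr0.
- rewrite pihomogX mcoeffX; case: (eqVneq m a) => [<-|/negbTE ne].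
    by case: ifP; rewrite ?mcoeff0 // mcoeffX eqxx.
  by case: ifP; rewrite ?mcoeff0 ?mcoeffX ?ne if_same.
Qed.

Lemma pihomogXM d m p :
  pihomog mdeg d ('X_[m] * p) =
  if (mdeg m <= d)%N then 'X_[m] * pihomog mdeg (d - mdeg m) p else 0.
Proof.
apply/mpolyP => a; rewrite mcoeff_pihomog mcoeffXM (fun_if (mcoeff a)).
rewrite mcoeff0 mcoeffXM mcoeff_pihomog.
have [le_ma|] := boolP (m <= a)%MM; last by rewrite !if_same.
have -> : mdeg a = (mdeg (a - m) + mdeg m)%N by rewrite -mdegD submK.
case: leqP => [le_md|lt_dm]; last by rewrite gtn_eqF // ltn_addl.
by rewrite -{1}(subnK le_md) eqn_add2r.
Qed.

(** When [h] gives normal forms of monomials, this is the normal form map on polynomials. *)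
Definition lin_ext h p := \sum_(m <- msupp p) p@_m *: h m.

(** A degree bound shared by several polynomials puts their sums over one index set, where linearity
    is termwise. *)
Lemma lin_extE h p k : (msize p <= k)%N ->
  lin_ext h p = \sum_(m : 'X_{1..n < k}) p@_m *: h m.
Proof.
move=> le_pk; set I : subFinType _ := 'X_{1..n < k}.
rewrite /lin_ext (big_mksub I) ?msupp_uniq //=; last first.
  by move=> x /msize_mdeg_lt /leq_trans; exact.
by rewrite big_rmcond //= => j /memN_msupp_eq0 ->; rewrite scale0r.
Qed.

Lemma lin_ext_is_linear h : linear (lin_ext h).
Proof.
move=> c p q; pose k := maxn (msize (c *: p + q)) (maxn (msize p) (msize q)).
rewrite !(lin_extE h (k := k)) ?leq_max ?leqnn ?orbT //.
rewrite scaler_sumr -big_split /=; apply: eq_bigr => m _.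
by rewrite mcoeffD mcoeffZ scalerDl scalerA.
Qed.

HB.instance Definition _ h :=
  GRing.isLinear.Build A Ax Ax _ (lin_ext h) (lin_ext_is_linear h).

Lemma lin_extX h m : lin_ext h 'X_[m] = h m.
Proof. by rewrite /lin_ext msuppX big_seq1 mcoeffX eqxx scale1r. Qed.

End MPoly.

Lemma map_mpoly_pihomog n (A B : comNzRingType) (f : {rmorphism A -> B}) d
    (p : {mpoly A[n]}) :
  map_mpoly f (pihomog mdeg d p) = pihomog mdeg d (map_mpoly f p).
Proof.
apply/mpolyP => a; rewrite mcoeff_map_mpoly !mcoeff_pihomog mcoeff_map_mpoly.
by case: (mdeg a == d); rewrite ?raddf0.
Qed.

Lemma map_lin_ext n (A B : comNzRingType) (f : {rmorphism A -> B})
    (h : 'X_{1..n} -> {mpoly A[n]}) p :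
  map_mpoly f (lin_ext h p) = lin_ext (map_mpoly f \o h) (map_mpoly f p).
Proof.
apply: (mpoly_supp_ind (P := fun p => map_mpoly f (lin_ext h p) =
  lin_ext (map_mpoly f \o h) (map_mpoly f p))) => [|q r|c q|m _].
- by rewrite !(raddf0, linear0).
- by move=> IHq IHr; rewrite linearD !rmorphD /= IHq IHr linearD.
- by move=> IH; rewrite linearZ /= !map_mpolyZ IH linearZ.
- by rewrite map_mpolyX !lin_extX.
Qed.

(** * Normal forms and the marked functor *)

Section MarkedFunctor.
Variables (n : nat) (J : set {mpoly int[n.+1]}).
Local Notation mon := 'X_{1..n.+1}.
Local Notation escalier A := (module_gen (monomials A (sous_escalier J))).

Section OneRing.
Variable A : comNzRingType.
Local Notation Ax := {mpoly A[n.+1]}.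
Implicit Types (I S U : set Ax) (p q : Ax) (m a b : mon) (h : mon -> Ax).

(** Membership in the module generated by the monomials outside [J], read off the coefficients. *)
Definition reduced p := forall a, mons J a -> p@_a = 0.

Lemma reduced0 : reduced 0.
Proof. by move=> a _; rewrite mcoeff0. Qed.

Lemma reducedD p q : reduced p -> reduced q -> reduced (p + q).
Proof. by move=> hp hq a Ja; rewrite mcoeffD hp ?hq ?addr0. Qed.

Lemma reducedZ c p : reduced p -> reduced (c *: p).
Proof. by move=> hp a Ja; rewrite mcoeffZ hp ?mulr0. Qed.

Lemma reducedB p q : reduced p -> reduced q -> reduced (p - q).
Proof. by move=> hp hq a Ja; rewrite mcoeffB hp ?hq ?subr0. Qed.

Lemma reducedX a : ~ mons J a -> reduced 'X_[a].
Proof.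
move=> nJa b Jb; rewrite mcoeffX; case: eqP => // eab.
by rewrite eab in nJa.
Qed.

Lemma module_gen_reduced p : escalier A p <-> reduced p.
Proof.
split.
  move: p; apply: smallest_sub; last by move=> _ [a nJa <-]; exact: reducedX.
  by split; [exact: reduced0 | exact: reducedD | exact: reducedZ].
move=> red_p K [[K0 KD KZ] subK]; apply: mpoly_supp_ind => // m.
rewrite mcoeff_msupp => /eqP pm0; apply: subK; exists m => //.
by move=> /red_p.
Qed.

(** Multiplication by a monomial only shifts homogeneous parts, so the generators decide. *)
Lemma homogeneous_ideal_gen S :
  (forall p d, S p -> ideal_gen S (pihomog mdeg d p)) ->
  homogeneous (ideal_gen S).
Proof.
move=> homS; have idS := ideal_gen_is_ideal S.
apply: smallest_sub => [|p Sp d]; last exact: homS.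
apply: mpoly_is_ideal => [d|p q hp hq d|c p hp d|m p hp d].
- by rewrite pihomog0; exact: (ideal0 idS).
- by rewrite pihomogD; apply: (idealD idS); [exact: hp | exact: hq].
- by rewrite linearZ; apply: (idealZ idS); exact: hp.
- rewrite pihomogXM; case: ifP => _; last exact: (ideal0 idS).
  by apply: (idealMl idS); exact: hp.
Qed.

(** Uniqueness is not built in: the universal ideal has normal forms in this sense although it may
    contain nonzero reduced polynomials, whose coefficients generate [frakI]. *)
Definition normal_forms I h := forall m,
  [/\ ~ mons J m -> h m = 'X_[m], reduced (h m) & I ('X_[m] - h m)].

(** The parameter [P] lets the chosen forms retain an extra property, later that of involving only
    smaller monomials. *)
Lemma normal_formsP I (P : mon -> Ax -> Prop) : is_ideal I ->
  (forall a, mons J a -> exists g, [/\ reduced g, I ('X_[a] - g) & P a g]) ->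
  exists h, normal_forms I h /\ forall a, mons J a -> P a (h a).
Proof.
move=> idI ex_h.
have /boolp.choice[h hP] m : exists g, [/\ ~ mons J m -> g = 'X_[m], reduced g,
    I ('X_[m] - g) & mons J m -> P m g].
  have [Jm|nJm] := pselect (mons J m).
    by by have [g [? ? ?]] := ex_h m Jm; exists g; split.
  exists 'X_[m]; split=> //; first exact: reducedX.
  by rewrite subrr; exact: (ideal0 idI).
by exists h; split=> m; have [] := hP m.
Qed.

Lemma lin_ext_reduced I h p : normal_forms I h -> reduced (lin_ext h p).
Proof.
move=> nf_h; apply: (mpoly_supp_ind (P := fun p => reduced (lin_ext h p))).
- by rewrite linear0; exact: reduced0.
- by move=> q r; rewrite linearD; exact: reducedD.
- by move=> c q; rewrite linearZ; exact: reducedZ.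
- by move=> m _; rewrite lin_extX; have [] := nf_h m.
Qed.

Lemma lin_ext_id I h p : normal_forms I h -> reduced p -> lin_ext h p = p.
Proof.
move=> nf_h red_p; rewrite [RHS]mpolyE; apply: eq_big_seq => m.
rewrite mcoeff_msupp => /eqP pm0; have [-> //] := nf_h m.
by move=> /red_p.
Qed.

Lemma ideal_lin_ext I h p :
  is_ideal I -> normal_forms I h -> I (p - lin_ext h p).
Proof.
move=> idI nf_h; apply: (mpoly_supp_ind (P := fun p => I (p - lin_ext h p))).
- by rewrite linear0 subr0; exact: (ideal0 idI).
- by move=> q r hq hr; rewrite linearD opprD addrACA; exact: (idealD idI).
- by move=> c q; rewrite linearZ -scalerBr; exact: (idealZ idI).
- by move=> m _; rewrite lin_extX; have [] := nf_h m.
Qed.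

Lemma direct_sum_normal_forms I h : is_ideal I -> normal_forms I h ->
  (forall p, I p -> reduced p -> p = 0) ->
  direct_sum_decomposition I (escalier A).
Proof.
move=> idI nf_h cap0; split.
  apply/seteqP; split=> [p [Ip /module_gen_reduced red_p] | _ -> /=].
    exact: cap0.
  by split; [exact: (ideal0 idI) | exact/module_gen_reduced/reduced0].
move=> p; exists (p - lin_ext h p), (lin_ext h p); split.
- exact: ideal_lin_ext.
- exact/module_gen_reduced/(lin_ext_reduced _ nf_h).
- by rewrite subrK.
Qed.

Lemma marked_ideal I : marked_functor J A I -> is_ideal I.
Proof. by case. Qed.

Lemma marked_cap0 I p : marked_functor J A I -> I p -> reduced p -> p = 0.
Proof.
move=> [_ _ [cap0 _]] Ip red_p.
have: (I `&` escalier A) p by split=> //; exact/module_gen_reduced.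
by rewrite cap0.
Qed.

(** The difference of two normal forms of [p] is reduced and lies in [I]. *)
Lemma marked_nf_unique I p q r : marked_functor J A I ->
  I (p - q) -> I (p - r) -> reduced q -> reduced r -> q = r.
Proof.
move=> mfI Iq Ir red_q red_r; apply/eqP; rewrite -subr_eq0; apply/eqP.
apply: (marked_cap0 mfI); last exact: reducedB.
have -> : q - r = (p - r) - (p - q) by rewrite opprB [RHS]addrC addrA subrK.
exact: (idealB (marked_ideal mfI)).
Qed.

Lemma marked_normal_forms I : marked_functor J A I -> exists h, normal_forms I h.
Proof.
move=> [idI homI [_ sumI]].
have [|h [nf_h _]] := @normal_formsP I (fun _ _ => True) idI; last by exists h.
move=> a _; have [f [g [If /module_gen_reduced red_g eX]]] := sumI 'X_[a].
by exists g; rewrite eX addrK.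
Qed.

Lemma marked_lin_ext0 I h p :
  marked_functor J A I -> normal_forms I h -> I p -> lin_ext h p = 0.
Proof.
move=> mfI nf_h Ip; have idI := marked_ideal mfI.
apply: (marked_cap0 mfI); last exact: lin_ext_reduced nf_h.
rewrite -[lin_ext h p](subKr p); apply: (idealB idI) => //.
exact: ideal_lin_ext.
Qed.

End OneRing.

Lemma reduced_map (A B : comNzRingType) (f : {rmorphism A -> B}) p :
  reduced p -> reduced (map_mpoly f p).
Proof. by move=> red_p a Ja; rewrite mcoeff_map_mpoly red_p ?raddf0. Qed.

(** * Base change of normal forms and of marked ideals *)

Section BaseChange.
Variables (A B : comNzRingType) (f : {rmorphism A -> B}).
Implicit Types (I U : set {mpoly A[n.+1]}).

Lemma base_change_is_ideal U : is_ideal (base_change f U).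
Proof. exact: ideal_gen_is_ideal. Qed.

Lemma base_change_map U p : U p -> base_change f U (map_mpoly f p).
Proof. by move=> Up; apply: sub_gen_smallest; exists p. Qed.

Lemma base_change_homogeneous U :
  homogeneous U -> homogeneous (base_change f U).
Proof.
move=> homU; apply: homogeneous_ideal_gen => _ d [p Up <-].
by rewrite -map_mpoly_pihomog; exact: (base_change_map (homU _ Up d)).
Qed.

Lemma base_change_normal_forms U h : normal_forms U h ->
  normal_forms (base_change f U) (map_mpoly f \o h).
Proof.
move=> nf_h m; have [h_out red_h Uh] := nf_h m; split=> [/h_out /= ->||].
- exact: map_mpolyX.
- exact: reduced_map.
- by rewrite -(map_mpolyX f) -rmorphB; exact: base_change_map.
Qed.

(** The images of the normal forms of [U] are normal forms for the extended ideal. The resulting map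
    vanishes on that ideal and fixes reduced polynomials, so the intersection is zero. It is applied
    to marked ideals and to the universal ideal. *)
Lemma base_change_marked U h :
  is_ideal U -> homogeneous U -> normal_forms U h ->
  (forall p, U p -> map_mpoly f (lin_ext h p) = 0) ->
  marked_functor J B (base_change f U).
Proof.
move=> idU homU nf_h lin_ext0.
have nf_fh := base_change_normal_forms nf_h.
split; [exact: base_change_is_ideal|exact: base_change_homogeneous|].
apply: (direct_sum_normal_forms (base_change_is_ideal U) nf_fh) => q Uq red_q.
(* Writing [q] as x^0 q allows the stronger claim that x^m q has normal form 0 for every [m], which
   is stable under multiplication by monomials. *)
rewrite -(lin_ext_id nf_fh red_q) -[q]mul1r -(mpolyX0 _ B).
move: q Uq {red_q} 0%MM; apply: smallest_sub; last first.
  move=> _ [p Up <-] m; rewrite -(map_mpolyX f) -rmorphM -map_lin_ext.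
  by apply: lin_ext0; exact: (idealMl idU).
apply: mpoly_is_ideal => [m|p q hp hq m|c p hp m|k p hp m].
- by rewrite mulr0 linear0.
- by rewrite mulrDr linearD /= hp hq addr0.
- by rewrite -scalerAr linearZ /= hp scaler0.
- by rewrite mulrA -mpolyXD.
Qed.

End BaseChange.

Lemma base_change_marked_functor (A B : comNzRingType) (f : {rmorphism A -> B}) I :
  marked_functor J A I -> marked_functor J B (base_change f I).
Proof.
move=> mfI; have [idI homI _] := mfI; have [h nf_h] := marked_normal_forms mfI.
apply: (base_change_marked idI homI nf_h) => p Ip.
by rewrite (marked_lin_ext0 mfI nf_h Ip) raddf0.
Qed.

End MarkedFunctor.

(** * Functoriality of base change *)

Section BaseChangeFunctoriality.
Variable n : nat.

Lemma base_change_id (A : comNzRingType) (I : set {mpoly A[n.+1]}) :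
  is_ideal I -> base_change (@idfun A) I = I.
Proof.
move=> idI; have map_id p : map_mpoly (@idfun A) p = p :> {mpoly A[n.+1]}.
  by apply/mpolyP => m; rewrite mcoeff_map_mpoly.
apply/seteqP; split; last by move=> p Ip; rewrite -[p]map_id; exact: base_change_map.
by apply: smallest_sub => // _ [p Ip <-]; rewrite map_id.
Qed.

Lemma base_change_comp (A B D : comNzRingType) (f : {rmorphism A -> B})
    (g : {rmorphism B -> D}) (I : set {mpoly A[n.+1]}) :
  base_change (g \o f) I = base_change g (base_change f I).
Proof.
have map_gf p :
    map_mpoly (g \o f) p = map_mpoly g (map_mpoly f p) :> {mpoly D[n.+1]}.
  by apply/mpolyP => m; rewrite !mcoeff_map_mpoly.
apply/seteqP; split; apply: smallest_sub; try exact: ideal_gen_is_ideal.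
  move=> _ [p Ip <-]; rewrite map_gf.
  by do 2!apply: base_change_map.
move=> _ [q Uq <-].
suff: base_change f I `<=` [set q | base_change (g \o f) I (map_mpoly g q)].
  exact.
apply: smallest_sub => [|_ [p Ip <-] /=].
  exact: (preimage_is_ideal (map_mpoly g) (ideal_gen_is_ideal _)).
by rewrite -map_gf; exact: base_change_map.
Qed.

End BaseChangeFunctoriality.

(** * The Groebner functor as a closed subfunctor *)

Section Groebner.
Variables (n : nat) (J : set {mpoly int[n.+1]}) (sigma : rel 'X_{1..n.+1}).
Local Notation mon := 'X_{1..n.+1}.
Hypotheses (idJ : is_ideal J) (sigma_ord : term_ordering sigma).

Definition slt a b := sigma a b && (a != b).

Lemma slt_irr a : ~ slt a a.
Proof. by rewrite /slt eqxx andbF. Qed.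

Lemma slt_trans b a c : slt a b -> slt b c -> slt a c.
Proof.
have [anti trans _ _ _] := sigma_ord.
move=> /andP[ab neab] /andP[bc _]; rewrite /slt (trans b) //=.
by apply: contra neab => /eqP eac; apply/eqP/anti; rewrite ab eac bc.
Qed.

Lemma sltNge a b : slt a b = ~~ sigma b a.
Proof.
have [anti _ tot _ _] := sigma_ord; have := tot a b; rewrite /slt.
have [<-|neab /=] := eqVneq a b; first by rewrite andbF orbb => ->.
case ab: (sigma a b); case ba: (sigma b a) => //= _.
by move: neab; rewrite (anti a b) ?eqxx // ab ba.
Qed.

Lemma slt_le a b : slt a b -> sigma a b. Proof. by case/andP. Qed.

Lemma mons_up a b : mons J a -> (a <= b)%MM -> mons J b.
Proof.
by move=> Ja le_ab; rewrite /mons /= -(submK le_ab) mpolyXD; exact: (idealMl idJ).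
Qed.

Section OneRing.
Variable A : comNzRingType.
Local Notation Ax := {mpoly A[n.+1]}.
Implicit Types (I : set Ax) (p q : Ax) (m a b : mon) (h : mon -> Ax).

Lemma is_leadP p a :
  is_lead sigma p a <-> p@_a != 0 /\ forall b, slt a b -> p@_b = 0.
Proof.
split=> [[]|[pa0 p0]]; rewrite ?mcoeff_msupp.
  move=> pa0 le_a; split=> // b lt_ab; apply: memN_msupp_eq0.
  by apply/negP => /le_a; apply/negP; rewrite -sltNge.
split=> [|b]; first by rewrite mcoeff_msupp.
by rewrite mcoeff_msupp; apply: contraR; rewrite -sltNge => /p0 ->.
Qed.

Lemma is_lead_exists p : p != 0 -> exists a, is_lead sigma p a.
Proof.
have [_ trans tot _ _] := sigma_ord.
rewrite -msupp_eq0 /is_lead; elim: (msupp p) => // a s IH _.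
have [->|/IH[b [sb le_b]]] := eqVneq s [::].
  exists a; split=> [|b]; rewrite inE // => /eqP ->.
  by have := tot a a; rewrite orbb.
have /orP[le_ab|le_ba] := tot a b.
  exists b; split=> [|c]; rewrite inE ?sb ?orbT // => /predU1P[->//|].
  exact: le_b.
exists a; split=> [|c]; rewrite inE ?eqxx // => /predU1P[->|/le_b le_cb].
  by have := tot a a; rewrite orbb.
exact: trans le_ba.
Qed.

Lemma is_leadXM m p a :
  is_lead sigma p a -> is_lead sigma ('X_[m] * p) (m + a)%MM.
Proof.
have [_ _ _ _ mono] := sigma_ord.
case=> pa le_a; split=> [|b]; rewrite mulrC (perm_mem (msuppMX _ _)).
  exact: map_f.
by case/mapP => c /le_a le_ca ->; rewrite ![(m + _)%MM]addmC; exact: mono.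
Qed.

Lemma ideal_gen_monomials (M : set mon) p :
  ideal_gen (monomials A M) p ->
  forall a, p@_a != 0 -> exists2 c, M c & (c <= a)%MM.
Proof.
move: p; apply: smallest_sub; last first.
  move=> _ [c Mc <-] a; rewrite mcoeffX; case: (eqVneq c a) => [<- _|_ /eqP//].
  by exists c => //; exact: lepm_refl.
apply: mpoly_is_ideal => [a|p q hp hq a|c p hp a|m p hp a].
- by rewrite mcoeff0 eqxx.
- rewrite mcoeffD; have [->|/hp //] := eqVneq p@_a 0.
  by rewrite add0r => /hq.
- rewrite mcoeffZ => cpa; apply: hp; apply: contraNneq cpa => ->.
  by rewrite mulr0.
- rewrite mcoeffXM; case: ifP => [le_ma /hp[c Mc le_c]|]; last by rewrite eqxx.
  by exists c => //; exact: lepm_trans le_c (lem_subr _ _).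
Qed.

Lemma ideal_overX a : ideal_over J A 'X_[a] <-> mons J a.
Proof.
split=> [/ideal_gen_monomials /(_ a)|Ja]; last by apply: sub_gen_smallest; exists a.
by rewrite mcoeffX eqxx oner_eq0 => -[//|c]; exact: mons_up.
Qed.

(** The working form of the Groebner condition: for marked ideals it is equivalent to membership in
    [groebner_functor], and it visibly survives base change. *)
Definition monic_leads I := forall d, mons J d ->
  exists p, [/\ I p, is_lead sigma p d & p@_d = 1].

Definition lower d p := forall b, ~~ slt b d -> p@_b = 0.

(** Division along [sigma]: cancel x^d with a monic element of [I] and reduce the smaller monomials
    that remain. *)
Lemma monic_leads_normal_forms I :
  is_ideal I -> homogeneous I -> monic_leads I ->
  exists h, normal_forms J I h /\ forall d, mons J d -> lower d (h d).
Proof.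
move=> idI homI monI; apply: (normal_formsP idI) => d Jd.
pose P d := mons J d -> exists g, [/\ reduced J g, I ('X_[d] - g) & lower d g].
apply: (bounded_mon_ind slt_irr slt_trans (P := P)) (leqnn (mdeg d)) Jd.
move: (mdeg d) => s {}d le_d IH Jd.
have [p [Ip /is_leadP[_ p_le] pd]] := monI d Jd.
(* The part of degree |d| stays in [I] and keeps the leading term x^d. The remaining monomials then
   have degree |d|, so the induction stays within finitely many monomials. *)
pose p' := pihomog mdeg (mdeg d) p.
have lt_p' : lower d ('X_[d] - p').
  move=> b; rewrite mcoeffB mcoeffX mcoeff_pihomog /slt negb_and negbK.
  have [<- _|neq] := eqVneq d b; first by rewrite eqxx pd subrr.
  rewrite orbF => nle; rewrite p_le ?if_same ?subrr //.
  by rewrite sltNge.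
(* [Q] is stable under linear combinations, so it suffices to treat each monomial of the tail, all
   of them below [d]. *)
pose Q q := exists g, [/\ reduced J g, I (q - g) & lower d g].
have [g [red_g Ig lt_g]] : Q ('X_[d] - p').
  apply: mpoly_supp_ind => [|q r [g [? ? lg]] [k [? ? lk]]|c q [g [? ? lg]]|b].
  - exists 0; split; [exact: reduced0 | by rewrite subr0; exact: (ideal0 idI)|].
    by move=> b _; rewrite mcoeff0.
  - exists (g + k); split; first exact: reducedD.
      by rewrite opprD addrACA; exact: (idealD idI).
    by move=> b hb; rewrite mcoeffD lg ?lk ?addr0.
  - exists (c *: g); split; first exact: reducedZ.
      by rewrite -scalerBr; exact: (idealZ idI).
    by move=> b hb; rewrite mcoeffZ lg ?mulr0.
  rewrite mcoeff_msupp => b_supp.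
  have lt_bd : slt b d by apply: contraR b_supp => /lt_p' ->.
  have [Jb|nJb] := pselect (mons J b); last first.
    exists 'X_[b]; split; [exact: reducedX | by rewrite subrr; exact: (ideal0 idI)|].
    move=> c; rewrite mcoeffX; case: eqP => // <-; by rewrite lt_bd.
  have le_b : (mdeg b <= s)%N.
    move: b_supp; rewrite mcoeffB mcoeffX mcoeff_pihomog.
    case: (eqVneq (mdeg b) (mdeg d)) => [->//|ne].
    by case: (eqVneq d b) ne => [->|_ _]; rewrite ?eqxx // subrr eqxx.
  have [g [red_g Ig lt_g]] := IH b le_b lt_bd Jb.
  exists g; split=> // c nlt; apply: lt_g; apply: contra nlt => lt_cb.
  exact: slt_trans lt_bd.
exists g; split=> //.
have -> : 'X_[d] - g = 'X_[d] - p' - g + p' by rewrite addrAC subrK.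
by apply: (idealD idI) => //; exact: homI.
Qed.

(** The normal form of [p] is 0. If x^c were outside [J], it would be its own normal form and occur
    in that of no other monomial of [p], so its coefficient in [p] would vanish. *)
Lemma lead_in_J I p c : is_ideal I -> (forall q, I q -> reduced J q -> q = 0) ->
  monic_leads I -> homogeneous I -> I p -> is_lead sigma p c -> mons J c.
Proof.
move=> idI cap0 monI homI Ip lead_p.
have [h [nf_h lt_h]] := monic_leads_normal_forms idI homI monI.
have /is_leadP[pc0 p_le] := lead_p.
apply: contrapT => nJc; move: pc0; apply/negP; rewrite negbK.
have /mpolyP/(_ c) : lin_ext h p = 0.
  apply: cap0 (lin_ext_reduced p nf_h).
  rewrite -[lin_ext h p](subKr p); apply: (idealB idI) => //.
  exact: ideal_lin_ext.
rewrite /lin_ext raddf_sum mcoeff0 /= (bigD1_seq c) ?msupp_uniq //=; last first.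
  by case: lead_p.
rewrite big_seq_cond big1 => [|m /andP[p_m ne_mc]].
  have [-> // _ _] := nf_h c.
  by rewrite addr0 mcoeffZ mcoeffX eqxx mulr1 => ->.
rewrite mcoeffZ; have [h_out _ _] := nf_h m.
have [Jm|/h_out ->] := pselect (mons J m); last first.
  by rewrite mcoeffX (negbTE ne_mc) mulr0.
rewrite (lt_h m Jm) ?mulr0 // sltNge negbK.
by case: lead_p => _ ->.
Qed.

(** Scaling the monic elements fills [LC] at monomials of [J]; at the others [lead_in_J] leaves only
    0. *)
Lemma monic_leads_groebner I : marked_functor J A I -> monic_leads I ->
  groebner_functor J sigma A I.
Proof.
move=> mfI monI; have [idI homI _] := mfI.
have leadJ p c : I p -> is_lead sigma p c -> mons J c.
  apply: lead_in_J => // q; exact: marked_cap0 mfI.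
split=> //.
  move=> a; have [Ja|nJa] := pselect (mons J a).
    right; apply/seteqP; split=> // c _.
    have [->|c0] := eqVneq c 0; [by right | left].
    have [p [Ip /is_leadP[_ p0] pa]] := monI a Ja.
    exists (c *: p); rewrite mcoeffZ pa mulr1; split=> //.
      exact: (idealZ idI).
    apply/is_leadP; rewrite mcoeffZ pa mulr1; split=> // b /p0 pb.
    by rewrite mcoeffZ pb mulr0.
  left; apply/seteqP; split=> [c [[p [Ip /leadJ Ja _]]|] //|c ->]; last by right.
  by case: nJa; exact: Ja.
rewrite /initial_ideal /ideal_over; congr (ideal_gen (monomials A _)).
apply/seteqP; split=> [a [p Ip lead_p]|a /monI[p [Ip lead_p _]]]; last by exists p.
exact: leadJ lead_p.
Qed.

(** A monomial of [J] is a multiple of some leading monomial x^c; monicity turns the leading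
    coefficient into 1, and multiplying by the cofactor moves x^c to x^d. *)
Lemma groebner_monic_leads I : groebner_functor J sigma A I -> monic_leads I.
Proof.
move=> [idI homI monI inI] d Jd.
have /ideal_gen_monomials/(_ d) : initial_ideal sigma I 'X_[d].
  by rewrite inI; exact/ideal_overX.
rewrite mcoeffX eqxx oner_eq0 => -[//|c [p Ip lead_p] le_cd].
have /is_leadP[pc0 _] := lead_p.
have : LC sigma I c 1.
  have [LC0|->//] := monI c; have : LC sigma I c p@_c by left; exists p.
  by rewrite LC0 /= => pc; rewrite pc eqxx in pc0.
case=> [[q [Iq lead_q qc]]|/= /eqP]; last by rewrite oner_eq0.
exists ('X_[d - c] * q); split; first exact: (idealMl idI).
  by rewrite -{2}(submK le_cd); exact: is_leadXM.
by have := mcoeffMX q (d - c) c; rewrite submK // mulrC qc.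
Qed.

(** A nonzero reduced element of [I] would have its leading monomial outside [J]. *)
Lemma groebner_marked I : groebner_functor J sigma A I -> marked_functor J A I.
Proof.
move=> stI; have [idI homI _ inI] := stI.
have [h [nf_h _]] :=
  monic_leads_normal_forms idI homI (groebner_monic_leads stI).
split=> //; apply: (direct_sum_normal_forms idI nf_h) => p Ip red_p.
apply/eqP; apply: contraT => /is_lead_exists[a lead_a].
have /is_leadP[+ _] := lead_a; rewrite red_p ?eqxx //.
apply/ideal_overX; rewrite -inI; apply: sub_gen_smallest.
by exists a => //; exists p.
Qed.

End OneRing.

Lemma base_change_groebner (A B : comNzRingType) (f : {rmorphism A -> B}) I :
  groebner_functor J sigma A I -> groebner_functor J sigma B (base_change f I).
Proof.
move=> stI; have mfI := groebner_marked stI.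
apply: monic_leads_groebner; first exact: base_change_marked_functor.
move=> d Jd; have [p [Ip /is_leadP[_ p0] pd]] := groebner_monic_leads stI Jd.
exists (map_mpoly f p); split; first exact: base_change_map.
  apply/is_leadP; rewrite mcoeff_map_mpoly pd /= rmorph1 oner_eq0; split=> // b.
  by rewrite mcoeff_map_mpoly => /p0 ->; rewrite raddf0.
by rewrite mcoeff_map_mpoly pd /= rmorph1.
Qed.

(** Normal forms of a marked ideal are unique and commute with base change, so the Groebner
    condition on the extension says that [f] kills certain coefficients. *)
Lemma closed_groebner :
  closed_subfunctor (groebner_functor J sigma) (marked_functor J).
Proof.
split; first split.
- split=> [A B f _ _ I|A _ I [idI _ _ _]|A B D f g _ _ _ I _].
  + exact: base_change_groebner.
  + exact: base_change_id.
  + exact: base_change_comp.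
- split=> [A B f _ _ I|A _ I [idI _ _]|A B D f g _ _ _ I _].
  + exact: base_change_marked_functor.
  + exact: base_change_id.
  + exact: base_change_comp.
- by move=> A _ I; exact: groebner_marked.
move=> A _ I mfI; have [h nf_h] := marked_normal_forms mfI.
(* The case b = d is harmless: that coefficient is already 0, since [h d] is reduced. *)
pose upper : set A :=
  [set c | exists d b, [/\ mons J d, ~~ slt b d & c = (h d)@_b]].
exists (ideal_span upper) => B f _.
have nf_fh := base_change_normal_forms f nf_h.
have mf_fI := base_change_marked_functor f mfI.
have [idfI homfI _] := mf_fI.
split=> [stfI|f0].
  apply: smallest_sub; first exact: kernel_is_ideal.
  move=> _ [d [b [Jd nlt ->]]] /=.
  have [g [nf_g lt_g]] :=
    monic_leads_normal_forms idfI homfI (groebner_monic_leads stfI).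
  have [_ red_g Ig] := nf_g d; have [_ red_h Ih] := nf_fh d.
  rewrite -mcoeff_map_mpoly [map_mpoly f _](marked_nf_unique mf_fI Ih Ig red_h red_g).
  exact: lt_g nlt.
apply: monic_leads_groebner => // d Jd; have [_ red_h Ih] := nf_fh d.
have lead1 : ('X_[d] - map_mpoly f (h d))@_d = 1.
  by rewrite mcoeffB mcoeffX eqxx (red_h d Jd) subr0.
exists ('X_[d] - map_mpoly f (h d)); split=> //.
apply/is_leadP; rewrite lead1 oner_eq0; split=> // b lt_db.
have /negbTE nlt : ~~ slt b d by apply/negP => /slt_trans /(_ lt_db)/slt_irr.
rewrite mcoeffB mcoeffX mcoeff_map_mpoly /= f0 ?subr0.
  by case: eqVneq lt_db => // -> /slt_irr.
by apply: sub_gen_smallest; exists d, b; rewrite nlt.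
Qed.

End Groebner.

(** * Star decomposition of the monomials of a strongly stable ideal *)

Section StarDecomposition.
Variables (n : nat) (J : set {mpoly int[n.+1]}).
Hypotheses (stableJ : strongly_stable J).
Local Notation mon := 'X_{1..n.+1}.
Implicit Types (a b c d : mon).

Lemma strongly_stable_ideal : is_ideal J.
Proof. by have [-> _] := stableJ; exact: ideal_gen_is_ideal. Qed.

(** The condition max(x^c) <= min(x^a) of the Eliahou-Kervaire decomposition. *)
Definition star_pair c a := forall i j, (0 < c i)%N -> (0 < a j)%N -> (i <= j)%N.

(** While x^d is not a minimal generator, its smallest variable can be split off without leaving
    [J]; these variables make up the cofactor. *)
Lemma star_decomposition d : mons J d ->
  exists a c, [/\ min_gens J a, star_pair c a & d = (c + a)%MM].
Proof.
have [k] := ubnP (mdeg d); elim: k d => // k IH d lt_k Jd.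
have [minJ|nmin] := pselect (min_gens J d).
  by exists d, 0%MM; split=> [//|i j|]; rewrite ?mnm0E ?add0m.
have [b [Jb le_bd ne_bd]] : exists b, [/\ mons J b, (b <= d)%MM & b <> d].
  apply: contrapT => nex; apply: nmin; split=> // b Jb le_bd.
  by apply: contrapT => ne_bd; apply: nex; exists b.
have [j lt_j] : exists j, (b j < d j)%N.
  apply: contrapT => nex; apply: ne_bd; apply/mnmP => j; apply/eqP.
  rewrite eqn_leq (mnm_lepP le_bd) leqNgt.
  by apply/negP => lt_j; apply: nex; exists j.
have d_j : (0 < d j)%N by exact: leq_ltn_trans lt_j.
have Jdj : mons J (d - U_(j))%MM.
  apply: (mons_up strongly_stable_ideal Jb); apply/mnm_lepP => i.
  rewrite mnmBE mnm1E; have [<-|_] := eqVneq j i.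
    by rewrite -ltnS subn1 prednK.
  by rewrite subn0; exact: (mnm_lepP le_bd).
pose i := [arg min_(i < j | (0 < d i)%N) (i : nat)].
have [d_i i_min] : (0 < d i)%N /\ forall k, (0 < d k)%N -> (i <= k)%N.
  by rewrite /i; case: arg_minnP.
(* Some x^d / x_j lies in [J]; strong stability exchanges its factor x_i for the larger x_j, which
   gives x^d / x_i. *)
have Jdi : mons J (d - U_(i))%MM.
  have [->//|ne_ij] := eqVneq i j.
  have lt_ij : (i < j)%N by rewrite ltn_neqAle i_min // ne_ij.
  have Jm := stableJ.2 _ j i Jdj _ lt_ij.
  have -> : (d - U_(i) = d - U_(j) - U_(i) + U_(j))%MM.
    apply/mnmP => l; rewrite mnmDE !mnmBE !mnm1E.
    have [<-|ne_jl] := eqVneq j l; last by rewrite subn0 addn0.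
    by rewrite (negbTE ne_ij) !subn0 subnK.
  by apply: Jm; rewrite mnmBE mnm1E eq_sym (negbTE ne_ij) subn0.
have Ui_d : (U_(i) <= d)%MM by rewrite lep1mP -lt0n.
have [|a [c [min_a star_ca e]]] := IH (d - U_(i))%MM _ Jdi.
  by move: lt_k; rewrite -{1}(submK Ui_d) mdegD mdeg1 addn1.
exists a, (c + U_(i))%MM; split=> //; last first.
  by rewrite -addmA [(U_(i) + a)%MM]addmC addmA -e submK.
move=> k' l; rewrite mnmDE mnm1E addn_gt0 => /orP[ck al|+ al].
  exact: star_ca.
case: eqVneq => // <- _; apply: i_min; apply: leq_trans al _.
have /mnm_lepP/(_ l) := lem_addl c a; rewrite -e => /leq_trans; apply.
exact: (mnm_lepP (lem_subr _ _)).
Qed.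

(** Lexicographic order in which the largest variable x_n is compared first. *)
Definition lex_lt c c' := exists i : 'I_n.+1,
  (c i < c' i)%N /\ forall k : 'I_n.+1, (i < k)%N -> c k = c' k.

Lemma lex_lt_irr c : ~ lex_lt c c.
Proof. by case=> i [+ _]; rewrite ltnn. Qed.

Lemma lex_lt_trans c2 c1 c3 : lex_lt c1 c2 -> lex_lt c2 c3 -> lex_lt c1 c3.
Proof.
move=> [i [lt_i eq_i]] [j [lt_j eq_j]]; have [lt_ij|lt_ji|/val_inj e] := ltngtP i j.
- exists j; rewrite eq_i //; split=> // k lt_jk.
  by rewrite eq_i ?eq_j //; exact: ltn_trans lt_jk.
- exists i; rewrite -(eq_j i) //; split=> // k lt_ik.
  by rewrite eq_i ?eq_j //; exact: ltn_trans lt_ik.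
- exists i; split; first by apply: ltn_trans lt_i _; rewrite e.
  by move=> k lt_ik; rewrite eq_i ?eq_j // -e.
Qed.

(** Look at the last index [i] where the cofactors differ. If c' were larger there, x^a would have
    no variable below x_i, agree with x^b above it and have a smaller exponent at it; then x^a would
    divide x^b, which is outside [J]. *)
Lemma star_lex_decrease a b c c' : mons J a -> ~ mons J b ->
  star_pair c' a -> (c + b = c' + a)%MM -> lex_lt c' c.
Proof.
move=> Ja nJb star_ca e; have ei k : (c k + b k = c' k + a k)%N.
  by have /mnmP/(_ k) := e; rewrite !mnmDE.
have [j ne_j] : exists j, c j != c' j.
  apply: contrapT => nex; apply: nJb; suff -> : b = a by [].
  have ecc : c = c'.
    by apply/mnmP => k; apply/eqP/negPn/negP => ne_k; apply: nex; exists k.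
  by move: e; rewrite ecc => /addmI.
pose i := [arg max_(i > j | c i != c' i) (i : nat)].
have [ne_i i_max] : c i != c' i /\ forall k, c k != c' k -> (k <= i)%N.
  by rewrite /i; case: arg_maxnP.
have eq_gt (k : 'I_n.+1) : (i < k)%N -> c' k = c k.
  by move=> lt_ik; apply/eqP/negPn/negP; rewrite eq_sym => /i_max; rewrite leqNgt lt_ik.
exists i; split=> //; rewrite ltn_neqAle eq_sym ne_i /= leqNgt.
apply/negP => lt_cc'; apply: nJb.
apply: (mons_up strongly_stable_ideal Ja); apply/mnm_lepP => k.
have [lt_ki|lt_ik|/val_inj eki] := ltngtP k i.
- have c'_i : (0 < c' i)%N by exact: leq_ltn_trans lt_cc'.
  have [->//|ak] := posnP (a k).
  by have := star_ca _ _ c'_i ak; rewrite leqNgt lt_ki.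
- by have := ei k; rewrite eq_gt // => /addnI ->.
- by rewrite -(leq_add2l (c' k)) -ei leq_add2r eki ltnW.
Qed.

End StarDecomposition.

(** * The universal ideal and its normal forms *)

Section Universal.
Variables (n : nat) (J : set {mpoly int[n.+1]}).
Hypotheses (stableJ : strongly_stable J).
Local Notation mon := 'X_{1..n.+1}.
Local Notation ZCx := {mpoly (ZC J)[n.+1]}.
Implicit Types (a b c d : mon).

Lemma Ccoef_neq0 a b : Ccoef J a b != 0 ->
  [/\ min_gens J a, sous_escalier J b & mdeg b = mdeg a].
Proof. by rewrite /Ccoef; case: insubP => /= [_ /asboolP //|]; rewrite eqxx. Qed.

Lemma mcoeff_marked_poly a m :
  (marked_poly J a)@_m = (a == m)%:R - Ccoef J a m.
Proof.
rewrite mcoeffB mcoeffX; congr (_ - _).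
(* Monomials of degree above |a| are missing from the sum, and there [Ccoef] has its default value
   0. *)
have [lt_m|le_m] := ltnP (mdeg m) (mdeg a).+1; first exact: mcoeff_mpoly.
rewrite (_ : Ccoef J a m = 0); last first.
  apply/eqP/negPn/negP => /Ccoef_neq0[_ _ e].
  by rewrite e ltnn in le_m.
rewrite raddf_sum big1 // => b _ /=; rewrite mcoeffZ mcoeffX.
case: eqP => [e|_]; last by rewrite mulr0.
by move: le_m; rewrite -e leqNgt bmdeg.
Qed.

Lemma universal_is_ideal : is_ideal (@universal_ideal n J).
Proof. exact: ideal_gen_is_ideal. Qed.

Lemma universal_marked_poly a : min_gens J a -> universal_ideal (marked_poly J a).
Proof. by move=> min_a; apply: sub_gen_smallest; exists a. Qed.

Lemma universal_homogeneous : homogeneous (@universal_ideal n J).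
Proof.
apply: homogeneous_ideal_gen => _ d [a min_a <-].
have [<-|ne] := eqVneq (mdeg a) d.
  rewrite (_ : pihomog _ _ _ = marked_poly J a); first exact: universal_marked_poly.
  apply/mpolyP => m; rewrite mcoeff_pihomog mcoeff_marked_poly.
  case: eqVneq => // ne; have [eam|_] := eqVneq a m.
    by rewrite eam eqxx in ne.
  rewrite sub0r; apply/eqP; rewrite eq_sym oppr_eq0; apply/negPn/negP.
  by case/Ccoef_neq0 => _ _ e; rewrite e eqxx in ne.
rewrite (_ : pihomog _ _ _ = 0); first exact: (ideal0 universal_is_ideal).
apply/mpolyP => m; rewrite mcoeff_pihomog mcoeff_marked_poly mcoeff0.
case: eqVneq => // e; have [eam|_] := eqVneq a m.
  by rewrite eam e eqxx in ne.
rewrite sub0r; apply/eqP; rewrite oppr_eq0; apply/negPn/negP.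
by case/Ccoef_neq0 => _ _ e'; rewrite -e' e eqxx in ne.
Qed.

Lemma universal_normal_forms : exists h, normal_forms J (@universal_ideal n J) h.
Proof.
have idU := universal_is_ideal.
(* Rewriting preserves the degree of x^c x^a, so [s] bounds all cofactors met and the lexicographic
   induction is finite. *)
pose P s c := forall a, (mdeg (c + a)%MM <= s)%N -> min_gens J a -> star_pair c a ->
  exists g : ZCx, reduced J g /\ universal_ideal ('X_[c + a] - g).
have PP s c : (mdeg c <= s)%N -> P s c.
  move: c; apply: (bounded_mon_ind (@lex_lt_irr n) (@lex_lt_trans n) (P := P s)) => c le_c IH.
  move=> a le_s min_a star_ca.
  pose Q (q : ZCx) := exists g, reduced J g /\ universal_ideal (q - g).
  have QD p q : Q p -> Q q -> Q (p + q).
    move=> [g [? ?]] [k [? ?]]; exists (g + k); split; first exact: reducedD.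
    by rewrite opprD addrACA; exact: (idealD idU).
  have QZ k q : Q q -> Q (k *: q).
    move=> [g [? ?]]; exists (k *: g); split; first exact: reducedZ.
    by rewrite -scalerBr; exact: (idealZ idU).
  have Q0 : Q 0 by exists 0; rewrite subr0; split; [exact: reduced0|exact: (ideal0 idU)].
  rewrite -/(Q _) mpolyXD.
  have -> : 'X_[a] = marked_poly J a + \sum_(b : 'X_{1..n.+1 < (mdeg a).+1})
      Ccoef J a b *: 'X_[b] by rewrite /marked_poly subrK.
  rewrite mulrDr; apply: (QD).
    exists 0; rewrite subr0; split; first exact: reduced0.
    by apply: (idealMl idU); exact: universal_marked_poly.
  rewrite mulr_sumr; apply: (big_ind Q Q0 QD) => b _; rewrite -scalerAr -mpolyXD.
  have [->|/Ccoef_neq0[_ nJb deg_b]] := eqVneq (Ccoef J a b) 0.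
    by rewrite scale0r.
  apply: QZ; have [Jcb|nJcb] := pselect (mons J (c + b)%MM); last first.
    exists 'X_[c + b]; rewrite subrr; split; first exact: reducedX.
    exact: (ideal0 idU).
  have [a' [c' [min_a' star_ca' e]]] := star_decomposition stableJ Jcb.
  have le_s' : (mdeg (c' + a')%MM <= s)%N by rewrite -e mdegD deg_b -mdegD.
  rewrite e; apply: IH => //; first by apply: leq_trans le_s'; rewrite mdegD leq_addr.
  exact: (star_lex_decrease stableJ min_a'.1 nJb star_ca' e).
have [|h [nf_h _]] := @normal_formsP _ J _ _ (fun _ _ => True) idU; last by exists h.
move=> d Jd; have [a [c [min_a star_ca ->]]] := star_decomposition stableJ Jd.
have [|g [? ?]] := PP _ c _ a (leqnn _) min_a star_ca; last by exists g.
by rewrite mdegD leq_addr.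
Qed.

End Universal.

(** * The universal property of integer polynomial rings *)

Section IntegerPolynomials.
Variables (K : choiceType) (A : comNzRingType).
Local Notation ZK := (malg (cmonom K) int).
Implicit Types (m : cmonom K).

Section Evaluation.
Variable v : K -> A.

Definition cmonom_eval m := \prod_(i <- finsupp m) v i ^+ m i.

(** Padding two monomials to a common support allows their values to be multiplied factor by
    factor. *)
Lemma cmonom_evalEw m (d : {fset K}) :
  (finsupp m `<=` d)%fset -> cmonom_eval m = \prod_(i <- d) v i ^+ m i.
Proof.
move=> le; rewrite /cmonom_eval (big_fset_incl _ le) // => i _.
by rewrite -cmE_eq0 => /eqP ->.
Qed.

Lemma cmonom_eval_mmorphism : mmorphism cmonom_eval.
Proof.
split=> [m1 m2|]; last by rewrite /cmonom_eval mdom1 big_seq_fset0.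
rewrite (@cmonom_evalEw m1 _ (fsubsetUl _ (finsupp m2))).
rewrite (@cmonom_evalEw m2 _ (fsubsetUr (finsupp m1) _)) /cmonom_eval mdomD.
by rewrite -big_split /=; apply: eq_bigr => i _; rewrite cmM exprD.
Qed.

HB.instance Definition _ :=
  monalg.isMultiplicative.Build (cmonom K) A cmonom_eval cmonom_eval_mmorphism.

Lemma malg_eval_exists :
  exists psi : {rmorphism ZK -> A}, forall i, psi (mkmalgU (ucm i) 1) = v i.
Proof.
exists (GRing.RMorphism.clone _ _ (monalg.mmap (intmul (1 : A)) cmonom_eval) _).
move=> i /=; rewrite monalg.mmapU mul1r /cmonom_eval mdomU big_seq_fset1.
by rewrite cmUU.
Qed.

End Evaluation.

(** Monomials are handled by splitting off one variable at a time; integer coefficients are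
    multiples of 1, hence respected by additivity. *)
Lemma malg_rmorphism_ext (f g : {rmorphism ZK -> A}) :
  (forall i, f (mkmalgU (ucm i) 1) = g (mkmalgU (ucm i) 1)) -> f =1 g.
Proof.
move=> eq_fg; have eq_mon m : f (mkmalgU m 1) = g (mkmalgU m 1).
  have [k] := ubnP (monalg.mdeg m); elim: k m => // k IH m lt_k.
  have [->|m1] := eqVneq m mone.
    by rewrite (_ : mkmalgU _ _ = 1) // !rmorph1.
  have [i m_i] : exists i, m i != 0%N.
    apply: contrapT => nex; case/eqP: m1; apply/eqP/cmP => i; rewrite onecmE.
    by apply/eqP/negPn/negP => m_i; apply: nex; exists i.
  have em : m = mmul (ucm i) (divcm m (ucm i)).
    apply/eqP/cmP => j; rewrite cmM divcmE ucmE.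
    by have [<-|_] := eqVneq i j; rewrite ?subnKC ?subn0 // lt0n.
  have -> : mkmalgU m 1 = mkmalgU (ucm i) 1 * mkmalgU (divcm m (ucm i)) 1 :> ZK.
    by rewrite malgM_def fgmulUU mulr1 -em.
  have lt_k' : (monalg.mdeg (divcm m (ucm i)) < k)%N.
    by move: lt_k; rewrite {1}em monalg.mdegM monalg.mdegU.
  move: (mkmalgU (ucm i) 1) (mkmalgU (divcm m (ucm i)) 1) (eq_fg i) (IH _ lt_k').
  by move=> x y fx fy; rewrite !rmorphM /= fx fy.
move=> p; rewrite [p]monalgE !rmorph_sum; apply: eq_bigr => m _ /=.
by rewrite -[monalg.mcoeff _ _]intz !raddfMz /= eq_mon.
Qed.

End IntegerPolynomials.

(** The bundled proofs agree by proof irrelevance. Injectivity of the representing map is an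
    equality of such bundles. *)
Lemma rmorphism_ext (R S : pzSemiRingType) (f g : {rmorphism R -> S}) :
  f =1 g -> f = g.
Proof.
move: f g => [f [[af] [mf]]] [g [[ag] [mg]]] /= /funext efg.
move: af mf ag mg; rewrite efg => af mf ag mg.
by rewrite (Prop_irrelevance af ag) (Prop_irrelevance mf mg).
Qed.

(** * The universal property of the quotient ring *)

Section QuotientUniversal.
Variables (R : comPzRingType) (I : ideal R).
Local Notation Q := (ring_quot I).

Definition rq_pi (x : R) : Q := (\pi_(ring_quot I) x)%qT.

Lemma rq_piP x y : ideal_set I (x - y) <-> rq_pi x = rq_pi y.
Proof. exact: ring_quotP. Qed.

Lemma rq_pi_is_additive : additive rq_pi.
Proof. by move=> x y; rewrite /rq_pi rq_addE rq_oppE. Qed.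

Lemma rq_pi_is_multiplicative : multiplicative rq_pi.
Proof.
by split=> [x y|]; rewrite /rq_pi ?rq_mulE // !piE.
Qed.

HB.instance Definition _ := GRing.isAdditive.Build R Q rq_pi rq_pi_is_additive.
HB.instance Definition _ :=
  GRing.isMultiplicative.Build R Q rq_pi rq_pi_is_multiplicative.

Section Lift.
Variables (A : comPzRingType) (psi : {rmorphism R -> A}).
Hypothesis psi0 : forall x, ideal_set I x -> psi x = 0.

(** The vanishing proof is an argument so that the morphism structures, which depend on it, can be
    attached to [rq_lift psi0]. *)
Definition rq_lift of (forall x, ideal_set I x -> psi x = 0) :=
  fun x : Q => psi (generic_quotient.repr x).

Lemma rq_lift_pi x : rq_lift psi0 (rq_pi x) = psi x.
Proof.
by apply/eqP; rewrite -subr_eq0 -rmorphB; apply/eqP/psi0/rq_repr.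
Qed.

Lemma rq_lift_is_additive : additive (rq_lift psi0).
Proof.
move=> x y; rewrite -[x]reprK -[y]reprK -!/(rq_pi _) -rmorphB !rq_lift_pi.
exact: rmorphB.
Qed.

Lemma rq_lift_is_multiplicative : multiplicative (rq_lift psi0).
Proof.
split=> [x y|]; last by rewrite -(rmorph1 rq_pi) rq_lift_pi rmorph1.
by rewrite -[x]reprK -[y]reprK -!/(rq_pi _) -rmorphM !rq_lift_pi rmorphM.
Qed.

HB.instance Definition _ :=
  GRing.isAdditive.Build Q A (rq_lift psi0) rq_lift_is_additive.
HB.instance Definition _ :=
  GRing.isMultiplicative.Build Q A (rq_lift psi0) rq_lift_is_multiplicative.

Lemma rq_lift_exists : exists phi : {rmorphism Q -> A}, phi \o rq_pi =1 psi.
Proof.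
by exists (GRing.RMorphism.clone _ _ (rq_lift psi0) _); exact: rq_lift_pi.
Qed.

End Lift.
End QuotientUniversal.

(** * Specializations of the universal ideal and representability *)

Section Representability.
Variables (n : nat) (J : set {mpoly int[n.+1]}) (sigma : rel 'X_{1..n.+1}).
Hypotheses (stableJ : strongly_stable J) (sigma_ord : term_ordering sigma).
Local Notation mon := 'X_{1..n.+1}.
Local Notation ZC := (ZC J).
Local Notation U := (@universal_ideal n J).
Let idJ := strongly_stable_ideal stableJ.

Section Specialization.
Variables (A : comNzRingType) (psi : {rmorphism ZC -> A}).

Lemma mcoeff_marked_poly_map a m :
  (map_mpoly psi (marked_poly J a))@_m = (a == m)%:R - psi (Ccoef J a m).
Proof. by rewrite mcoeff_map_mpoly mcoeff_marked_poly raddfB /= rmorph_nat. Qed.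

(** For [p] in the universal ideal, the normal form of [p] is again in it and reduced, so its
    coefficients are generators of [frakI], killed by [psi]. *)
Lemma specialization_marked :
  (forall c, ideal_set (frakI J) c -> psi c = 0) ->
  marked_functor J A (base_change psi U).
Proof.
move=> psi0; have [h nf_h] := universal_normal_forms stableJ.
have idU := @universal_is_ideal n J.
apply: (base_change_marked idU (@universal_homogeneous _ _) nf_h).
move=> p Up; apply/mpolyP => m; rewrite mcoeff_map_mpoly mcoeff0 /=.
apply: psi0; apply: sub_gen_smallest; exists (lin_ext h p), m; split=> //.
  rewrite -[lin_ext h p](subKr p); apply: (idealB idU) => //.
  exact: ideal_lin_ext.
exact/module_gen_reduced/(lin_ext_reduced _ nf_h).
Qed.

Lemma universal_ideal_sub I : is_ideal I ->
  (forall a, min_gens J a -> I (map_mpoly psi (marked_poly J a))) ->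
  U `<=` [set p | I (map_mpoly psi p)].
Proof.
move=> idI Ipoly; apply: smallest_sub; first exact: preimage_is_ideal.
by move=> _ [a min_a <-]; exact: Ipoly.
Qed.

(** Reduced elements of the universal ideal map to reduced elements of [I], that is, to 0. *)
Lemma marked_kills_frakI I : marked_functor J A I ->
  (forall a, min_gens J a -> I (map_mpoly psi (marked_poly J a))) ->
  forall c, ideal_set (frakI J) c -> psi c = 0.
Proof.
move=> mfI Ipoly; apply: smallest_sub; first exact: kernel_is_ideal.
move=> _ [p [m [Up /module_gen_reduced red_p ->]]] /=.
rewrite -mcoeff_map_mpoly [map_mpoly psi p](marked_cap0 mfI) ?mcoeff0 //.
  by apply: (universal_ideal_sub (marked_ideal mfI) Ipoly).
exact: reduced_map.
Qed.

Lemma frakI_sub c : ideal_set (frakI J) c -> ideal_set (frakI_sigma J sigma) c.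
Proof.
move=> Ic; exists c, 0; split=> //; last by rewrite addr0.
exact: (ideal0 (ideal_setP (frakG J sigma))).
Qed.

Lemma frakG_sub c : ideal_set (frakG J sigma) c -> ideal_set (frakI_sigma J sigma) c.
Proof.
move=> Gc; exists 0, c; split=> //; last by rewrite add0r.
exact: (ideal0 (ideal_setP (frakI J))).
Qed.

Lemma specialization_groebner :
  (forall c, ideal_set (frakI_sigma J sigma) c -> psi c = 0) ->
  groebner_functor J sigma A (base_change psi U).
Proof.
move=> psi0; have idI := base_change_is_ideal psi U.
apply: (monic_leads_groebner sigma_ord).
  by apply: specialization_marked => c /frakI_sub; exact: psi0.
move=> d Jd; have [a [c [min_a _ ->]]] := star_decomposition stableJ Jd.
(* For b above a this is the vanishing on [frakG]; for b = a there is no variable, as x^a lies in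
   [J]. *)
have Caa b : sigma a b -> psi (Ccoef J a b) = 0.
  move=> le_ab; have [->|Cab] := eqVneq (Ccoef J a b) 0; first exact: rmorph0.
  have [_ nJb _] := Ccoef_neq0 Cab.
  apply: psi0; apply: frakG_sub; apply: sub_gen_smallest; move: Cab.
  rewrite /Ccoef; case: insubP => /= [i _ ei _|]; last by rewrite eqxx.
  exists i => //; rewrite /= ei; split=> //= eab.
  by apply: nJb; rewrite -eab; case: min_a.
have [_ _ tot _ _] := sigma_ord.
have lead_a : is_lead sigma (map_mpoly psi (marked_poly J a)) a.
  apply/(is_leadP sigma_ord); rewrite mcoeff_marked_poly_map eqxx.
  rewrite Caa ?subr0 ?oner_eq0; last by have := tot a a; rewrite orbb.
  split=> // b lt_ab; rewrite mcoeff_marked_poly_map (Caa _ (slt_le lt_ab)).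
  by rewrite subr0; move: lt_ab; have [->/slt_irr|] := eqVneq a b.
exists ('X_[c] * map_mpoly psi (marked_poly J a)); split.
- apply: (idealMl idI); apply: base_change_map.
  exact: universal_marked_poly.
- exact: is_leadXM.
rewrite mulrC mcoeffMX mcoeff_marked_poly_map eqxx Caa ?subr0 //.
by have := tot a a; rewrite orbb.
Qed.

(** The extended ideal lies in [I] and already provides normal forms. For [p] in [I] that form is
    reduced and in [I], hence 0, so [p] belongs to the extended ideal. *)
Lemma marked_specialization I : marked_functor J A I ->
  (forall a, min_gens J a -> I (map_mpoly psi (marked_poly J a))) ->
  base_change psi U = I.
Proof.
move=> mfI Ipoly; have idI := marked_ideal mfI.
have sub : base_change psi U `<=` I.
  apply: smallest_sub => // _ [p Up <-].
  exact: (universal_ideal_sub idI Ipoly).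
apply/seteqP; split=> // p Ip.
have [h nf_h] := universal_normal_forms stableJ.
have nf_ph := base_change_normal_forms psi nf_h.
have Ihp := ideal_lin_ext p (base_change_is_ideal psi U) nf_ph.
rewrite -[p]subr0 -[0](marked_cap0 mfI _ (lin_ext_reduced p nf_ph)) //.
rewrite -[lin_ext _ p](subKr p); apply: (idealB idI) => //; exact: sub.
Qed.

End Specialization.

(** The values of the variables C_ab are the coefficients of the unique normal form of x^a modulo
    [I]. *)
Lemma specialization_inj (A : comNzRingType) (psi1 psi2 : {rmorphism ZC -> A}) I :
  marked_functor J A I ->
  base_change psi1 U = I -> base_change psi2 U = I -> psi1 =1 psi2.
Proof.
move=> mfI e1 e2; apply: malg_rmorphism_ext => i.
have /asboolP[min_a nJb deg_b] := valP i.
set a := (val i).1 in min_a nJb deg_b *; set b := (val i).2 in nJb deg_b *.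
have Ci (psi : {rmorphism ZC -> A}) : base_change psi U = I ->
    I ('X_[a] - ('X_[a] - map_mpoly psi (marked_poly J a))) /\
    reduced J ('X_[a] - map_mpoly psi (marked_poly J a)).
  move=> eI; rewrite subKr -{1}eI; split.
    by apply: base_change_map; exact: universal_marked_poly.
  move=> c Jc; rewrite mcoeffB mcoeffX mcoeff_marked_poly_map subKr.
  have [->|/Ccoef_neq0[_ nJc _]] := eqVneq (Ccoef J a c) 0; first exact: rmorph0.
  by case: nJc.
have [I1 red1] := Ci _ e1; have [I2 red2] := Ci _ e2.
have /mpolyP/(_ b) := marked_nf_unique mfI I1 I2 red1 red2.
rewrite !mcoeffB !mcoeff_marked_poly_map !mcoeffX !subKr.
by rewrite /Ccoef /a /b -surjective_pairing valK.
Qed.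

Lemma specialization_surj (A : comNzRingType) I :
  groebner_functor J sigma A I ->
  exists psi : {rmorphism ZC -> A},
    (forall c, ideal_set (frakI_sigma J sigma) c -> psi c = 0) /\
    base_change psi U = I.
Proof.
move=> stI; have mfI := groebner_marked idJ sigma_ord stI.
have [idI homI _] := mfI.
have [h [nf_h lt_h]] := monic_leads_normal_forms sigma_ord idI homI
  (groebner_monic_leads idJ sigma_ord stI).
have [psi psiC] := malg_eval_exists (fun i : Cindex J => (h (val i).1)@_(val i).2).
have psi_poly a : min_gens J a ->
    map_mpoly psi (marked_poly J a) = 'X_[a] - h a.
  move=> min_a; have [_ red_h Ih] := nf_h a.
  (* The part of degree |a| is also a normal form of x^a, so uniqueness makes [h a] homogeneous; its
     coefficients thus all correspond to variables C_ab. *)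
  have hom_h : h a = pihomog mdeg (mdeg a) (h a).
    apply: (marked_nf_unique mfI Ih _ red_h) => [|c Jc].
      rewrite -[X in X - _](_ : pihomog mdeg (mdeg a) 'X_[a] = _).
        by rewrite -pihomogB; exact: homI.
      by rewrite pihomogX eqxx.
    by rewrite mcoeff_pihomog red_h ?if_same.
  apply/mpolyP => b; rewrite mcoeff_marked_poly_map mcoeffB mcoeffX.
  congr (_ - _); rewrite /Ccoef; case: insubP => [i _ ei|/asboolPn ncond] /=.
    by rewrite psiC ei.
  rewrite rmorph0; have [Jb|nJb] := pselect (mons J b); first by rewrite red_h.
  rewrite hom_h mcoeff_pihomog; case: eqP => // deg_b.
  by case: ncond; split.
exists psi; have Ipoly a : min_gens J a -> I (map_mpoly psi (marked_poly J a)).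
  by move=> min_a; rewrite psi_poly //; have [] := nf_h a.
split; last exact: marked_specialization.
move=> _ [u [v [Iu Gv ->]]]; rewrite rmorphD (marked_kills_frakI mfI Ipoly Iu) add0r.
suff: frakG J sigma `<=` [set c | psi c = 0] by exact.
apply: smallest_sub; first exact: kernel_is_ideal.
move=> _ [i [le_ab ne_ab] <-] /=; rewrite psiC.
have /asboolP[min_a _ _] := valP i.
apply: lt_h; first by case: min_a.
by rewrite sltNge // negbK.
Qed.

Lemma represented_groebner :
  represented_by_Spec (groebner_functor J sigma) (ring_quot (frakI_sigma J sigma)).
Proof.
pose Q := ring_quot (frakI_sigma J sigma).
pose pi : {rmorphism ZC -> Q} := @rq_pi _ (frakI_sigma J sigma).
exists (fun (A : comNzRingType) (phi : {rmorphism Q -> A}) => base_change (phi \o pi) U).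
split=> [A _|A B f _ _ phi]; last first.
  exact: (base_change_comp (GRing.RMorphism.clone _ _ (phi \o pi) _) f U).
(* The projection kills [frakI_sigma], so every morphism from the quotient yields a Groebner ideal;
   conversely [specialization_surj] gives a morphism that factors through the quotient. *)
have phi_st (phi : {rmorphism Q -> A}) :
    groebner_functor J sigma A (base_change (phi \o pi) U).
  apply: specialization_groebner => c Ic /=.
  rewrite (_ : pi c = 0) ?rmorph0 // -(rmorph0 pi).
  by apply/rq_piP; rewrite subr0.
split=> [phi _|phi1 phi2 _ _ eq_phi|I stI]; first exact: phi_st.
  apply: rmorphism_ext => x.
  rewrite -[x]reprK; apply: (specialization_inj _ eq_phi erefl).
  exact/(groebner_marked idJ sigma_ord)/phi_st.
have [psi [psi0 <-]] := specialization_surj stI.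
have [phi phi_pi] := rq_lift_exists psi0.
by exists phi => //; rewrite (funext phi_pi).
Qed.

End Representability.

Theorem theorem5p3 (n m : nat) (J : set {mpoly int[n.+1]})
    (sigma : rel 'X_{1..n.+1}) :
  strongly_stable J -> is_truncation m J -> term_ordering sigma ->
  closed_subfunctor (groebner_functor J sigma) (marked_functor J) /\
  represented_by_Spec (groebner_functor J sigma)
    (ring_quot (frakI_sigma J sigma)).
Proof.
move=> stableJ _ sigma_ord; split; last exact: represented_groebner.
exact: (closed_groebner (strongly_stable_ideal stableJ) sigma_ord).
Qed.
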